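(* Let $M$ be an $\omega$-saturated 1-t.t.t structure, let $n\ge1$, and let $X\subset M_t^n$ be a dense definable set. Then the interior $\mathrm{int}(X)$ is dense in $M_t^n$ as well.
   Context: Definable means definable with parameters. First order topological structure: let $M$ be a two-sorted $L$-structure with sorts $M_t$ and $M_b$, and let $\phi(x,y_1,\dots,y_m)$ be an $L$-formula such that $\{\phi^{M_t}(x,\bar a) : \bar a\in M_b^m\}$ (the subsets of $M_t$ defined by the formulas $\phi(x,\bar a)$) is a basis for a topology on $M_t$. Then $(M,\phi)$ is a first order topological structure. $M_t$ carries this topology and $M_t^n$ the product topology. Condition (A): every definable $X\subset M_t$ is a boolean combination of definable open subsets of $M_t$. Let $M$ be a first order topological structure satisfying (A) with $M_t$ Hausdorff. For closed definable $X\subset M_t$, the ordinal-valued dimension $D_M(X)$ is defined by: (1) if $X\ne\emptyset$ then $D_M(X)\ge 0$; (2) if $\delta$ is a limit ordinal and $D_M(X)\ge\alpha$ for all $\alpha<\delta$, then $D_M(X)\ge\delta$; (3) if there is a closed definable $Y\subset X$ with no interior in $X$ and $D_M(Y)\ge\alpha$, then $D_M(X)\ge\alpha+1$. Write $D_M(X)=\alpha$ if $D_M(X)\ge\alpha$ and $D_M(X)\not\ge\alpha+1$, and $D_M(X)=\infty$ if $D_M(X)\ge\alpha$ for all $\alpha$. $M$ has dimension if $D_M(X)\neq\infty$ for all closed definable $X\subset M_t$. For definable $X\subset M_t$, $d_M(X)$ is the maximum $d<\omega$ such that $X$ is a union of $d$ disjoint nonempty definable sets that are clopen in $X$, and $d_M(X)=\infty$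 if no maximum exists. $M$ is topologically totally transcendental (t.t.t) if it is a first order topological structure satisfying (A), $M_t$ is Hausdorff, $M$ has dimension, and $d_M(X)<\infty$ for every definable $X\subset M_t$. $M$ is 1-t.t.t (one-dimensional t.t.t) if it is t.t.t and $D_M(M_t)=1$. *)

(* Defs.v *)
From HB Require Import structures.
From mathcomp Require Import all_boot all_classical topology.

Set Implicit Arguments.
Unset Strict Implicit.
Unset Printing Implicit Defensive.

Local Open Scope classical_set_scope.

(** * Two-sorted first-order logic *)

(* [Top] is the sort of M_t (the points), [Bas] the sort of M_b (the
   parameters of basic open sets). *)
Inductive fo_sort : Set := Top | Bas.

Record language := Language {
  fsym : Type;
  farity : fsym -> nat;
  fdom : forall f : fsym, 'I_(farity f) -> fo_sort;
  fcod : fsym -> fo_sort;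
  rsym : Type;
  rarity : rsym -> nat;
  rdom : forall r : rsym, 'I_(rarity r) -> fo_sort
}.

(* Each sort has its own variables, indexed by [nat]; binding is de Bruijn
   style, separately for each sort: [FEx s phi] binds variable 0 of sort [s]
   and leaves the indices of the other sort alone. *)
Inductive term (L : language) : fo_sort -> Type :=
| Var (s : fo_sort) (i : nat) : term L s
| App (f : fsym L) (ts : forall j : 'I_(farity f), term L (fdom j)) :
    term L (fcod f).

Inductive formula (L : language) : Type :=
| FEq (s : fo_sort) (t1 t2 : term L s)
| FRel (r : rsym L) (ts : forall j : 'I_(rarity r), term L (rdom j))
| FNeg (phi : formula L)
| FAnd (phi psi : formula L)
| FEx (s : fo_sort) (phi : formula L).

Definition bump_sort (s : fo_sort) (k : fo_sort -> nat) : fo_sort -> nat :=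
  match s with
  | Top => fun s' => if s' is Top then (k Top).+1 else k Bas
  | Bas => fun s' => if s' is Bas then (k Bas).+1 else k Top
  end.

Fixpoint term_in (L : language) (k : fo_sort -> nat) (s : fo_sort)
    (t : term L s) : Prop :=
  match t with
  | Var s i => (i < k s)%N
  | App _ ts => forall j, term_in k (ts j)
  end.

(* The free variables of sort [s] of the formula have indices [< k s]. *)
Fixpoint formula_in (L : language) (k : fo_sort -> nat) (phi : formula L)
    : Prop :=
  match phi with
  | FEq _ t1 t2 => term_in k t1 /\ term_in k t2
  | FRel _ ts => forall j, term_in k (ts j)
  | FNeg phi => formula_in k phi
  | FAnd phi psi => formula_in k phi /\ formula_in k psi
  | FEx s phi => formula_in (bump_sort s k) phi
  end.

Record structure (L : language) := Structure {
  carrier :> fo_sort -> Type;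
  carrier_inhabited : forall s, inhabited (carrier s);
  fun_int : forall f : fsym L,
    (forall j : 'I_(farity f), carrier (fdom j)) -> carrier (fcod f);
  rel_int : forall r : rsym L,
    (forall j : 'I_(rarity r), carrier (rdom j)) -> Prop
}.

Definition env (L : language) (M : structure L) :=
  forall s : fo_sort, nat -> M s.

Definition econs (L : language) (M : structure L) (s : fo_sort) :
    M s -> env M -> env M :=
  match s return M s -> env M -> env M with
  | Top => fun a e s' =>
      match s' return nat -> M s' with
      | Top => fun i => if i is j.+1 then e Top j else a
      | Bas => e Bas
      end
  | Bas => fun a e s' =>
      match s' return nat -> M s' with
      | Top => e Top
      | Bas => fun i => if i is j.+1 then e Bas j else a
      end
  end.

Fixpoint eval (L : language) (M : structure L) (e : env M) (s : fo_sort)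
    (t : term L s) : M s :=
  match t with
  | Var s i => e s i
  | App _ ts => fun_int (fun j => eval e (ts j))
  end.

Fixpoint sat (L : language) (M : structure L) (phi : formula L) (e : env M)
    : Prop :=
  match phi with
  | FEq _ t1 t2 => eval e t1 = eval e t2
  | FRel _ ts => rel_int (fun j => eval e (ts j))
  | FNeg phi => ~ sat phi e
  | FAnd phi psi => sat phi e /\ sat psi e
  | FEx s phi => exists a : M s, sat phi (econs a e)
  end.

(* A formula with parameters from [A] is a pair [(phi, e)] where [e] takes its
   values in [A]; its free variable [x] is variable 0 of sort [s], the other
   free variables of [phi] being interpreted by [e].  Pairs [(phi, e)] exist
   only if [A] meets both sorts; this is harmless since any finite set of
   parameters is contained in such a finite [A].  A type over [A] is a set of
   such formulas that is finitely satisfiable in [M]. *)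
Definition omega_saturated (L : language) (M : structure L) : Prop :=
  forall (s : fo_sort) (A : forall s', set (M s'))
         (p : set (formula L * env M)),
    (forall s', finite_set (A s')) ->
    (forall psi, p psi -> forall s' i, A s' (psi.2 s' i)) ->
    (forall q : set (formula L * env M), finite_set q -> q `<=` p ->
       exists a : M s, forall psi, q psi -> sat psi.1 (econs a psi.2)) ->
    exists a : M s, forall psi, p psi -> sat psi.1 (econs a psi.2).

(** * First-order topological structures *)

Definition is_base (T : Type) (B : set (set T)) : Prop :=
  \bigcup_(U in B) U = setT /\
  forall U V x, B U -> B V -> U x -> V x ->
    exists W, [/\ B W, W x & W `<=` U `&` V].

(* The subsets [phi(x, a)] of M_t, where x is variable 0 of sort [Top] and
   y_1, ..., y_m are variables 0, ..., m-1 of sort [Bas].  When these are the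
   only free variables of [phi], the remaining values of [e] are irrelevant,
   so that [e] stands for a tuple in M_b^m. *)
Definition basic_sets (L : language) (M : structure L) (phi : formula L)
    : set (set (M Top)) :=
  [set U | exists e : env M, U = [set x | sat phi (econs (s := Top) x e)]].
Arguments basic_sets {L} M phi.

Record top_structure (L : language) := TopStructure {
  ts_structure :> structure L;
  ts_arity : nat;
  ts_formula : formula L;
  ts_formula_in :
    formula_in (fun s => if s is Top then 1 else ts_arity) ts_formula;
  ts_base : is_base (basic_sets ts_structure ts_formula)
}.

Definition points (L : language) (M : top_structure L) : Type := M Top.

Section PointsTopology.
Variables (L : language) (M : top_structure L).

HB.instance Definition _ := gen_eqMixin (points M).
HB.instance Definition _ := gen_choiceMixin (points M).

Let base_cover :
  \bigcup_(U in basic_sets M (ts_formula M)) (U : set (points M)) = setT.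
Proof. exact: (ts_base M).1. Qed.

Let base_join (U V : set (points M)) (x : points M) :
  basic_sets M (ts_formula M) U -> basic_sets M (ts_formula M) V ->
  U x -> V x ->
  exists W : set (points M),
    [/\ basic_sets M (ts_formula M) W, W x & W `<=` U `&` V].
Proof. exact: (ts_base M).2. Qed.

HB.instance Definition _ :=
  isBaseTopological.Build (points M) base_cover base_join.

Lemma open_pointsP (U : set (points M)) :
  open U <-> forall x, U x ->
    exists W, [/\ basic_sets M (ts_formula M) W, W x & W `<=` U].
Proof.
split=> [[D' D'base <-] x [V /= D'V Vx]|Ubase].
  by exists V; split=> //; [exact: D'base | exact: bigcup_sup].
exists [set V | basic_sets M (ts_formula M) V /\ V `<=` U].
  by move=> V [].
apply/seteqP; split=> [x [V [_ VU] Vx]|x Ux]; first exact: VU.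
by have [W [baseW Wx WU]] := Ubase x Ux; exists W.
Qed.

End PointsTopology.

(* M_t^n with the product topology. *)
Notation power M n := {ptws 'I_n -> points M}.

(** * Definable sets (with parameters) *)

Definition evec (L : language) (M : top_structure L) (n : nat)
    (x : power M n) (e : env M) : env M :=
  fun s => match s return nat -> M s with
  | Top => fun i => if insub i is Some j then x j else e Top i
  | Bas => e Bas
  end.

Definition definable (L : language) (M : top_structure L) (n : nat)
    (X : set (power M n)) : Prop :=
  exists (phi : formula L) (e : env M), X = [set x | sat phi (evec x e)].

Definition definable1 (L : language) (M : top_structure L)
    (X : set (points M)) : Prop :=
  definable [set x : power M 1 | X (x ord0)].

Inductive boolean_combination (T : Type) (G : set (set T)) : set (set T) :=
| BoolGen U : G U -> boolean_combination G U
| BoolCompl U : boolean_combination G U -> boolean_combination G (~` U)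
| BoolInter U V : boolean_combination G U -> boolean_combination G V ->
    boolean_combination G (U `&` V).

Definition condition_A (L : language) (M : top_structure L) : Prop :=
  forall X : set (points M), definable1 X ->
    boolean_combination [set U : set (points M) | definable1 U /\ open U] X.

(** * Dimension *)

(* Ordinals, presented as well-founded trees: [OLim f] denotes the supremum of
   the nonempty family [f].  Every ordinal is denoted by some tree. *)
Inductive ordinal_tree : Type :=
| OZero
| OSucc (a : ordinal_tree)
| OLim (I : Type) (i0 : I) (f : I -> ordinal_tree).

(* D_M(X) >= a.  That the supremum of [f] need not be a limit ordinal in the
   last case does no harm: the relation is antitone in the ordinal. *)
Fixpoint dim_ge (L : language) (M : top_structure L) (a : ordinal_tree)
    (X : set (points M)) : Prop :=
  match a with
  | OZero => X !=set0
  | OSucc b => exists Y : set (points M),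
      [/\ closed Y, definable1 Y, Y `<=` X,
          interior (Y : set (subspace X)) = set0 & dim_ge b Y]
  | OLim _ _ f => forall i, dim_ge (f i) X
  end.

Definition dim_eq (L : language) (M : top_structure L) (X : set (points M))
    (a : ordinal_tree) : Prop :=
  dim_ge a X /\ ~ dim_ge (OSucc a) X.

Definition has_dimension (L : language) (M : top_structure L) : Prop :=
  forall X : set (points M), closed X -> definable1 X ->
    exists a, ~ dim_ge a X.

(* [X] is a union of [d] disjoint nonempty definable sets clopen in [X]. *)
Definition splits (L : language) (M : top_structure L) (X : set (points M))
    (d : nat) : Prop :=
  exists C : 'I_d -> set (points M),
    [/\ forall i, [/\ definable1 (C i), C i !=set0 &
                      clopen (C i : set (subspace X))],
        trivIset setT C & \bigcup_i C i = X].

Definition d_eq (L : language) (M : top_structure L) (X : set (points M))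
    (d : nat) : Prop :=
  splits X d /\ forall d', splits X d' -> (d' <= d)%N.

Definition ttt (L : language) (M : top_structure L) : Prop :=
  [/\ condition_A M, hausdorff_space (points M), has_dimension M &
      forall X : set (points M), definable1 X -> exists d, d_eq X d].

Definition one_ttt (L : language) (M : top_structure L) : Prop :=
  ttt M /\ dim_eq [set: points M] (OSucc OZero).

(* Main.v *)
Require Import Defs.
From mathcomp Require Import all_boot all_classical topology.

(** In a 1-t.t.t structure a closed definable set without interior is discrete,
    hence finite, as [d_M] is finite; by condition (A) every definable subset of
    M_t then has a finite boundary.  By saturation, for [X] definable in
    M_t^(n+1) the boundaries of the fibers [X_x] have fewer than [N] points for
    some [N] independent of [x].  Inside a given open set choose disjoint open
    definably connected sets [W_1, ..., W_N]: the boundary of each [X_x] misses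
    some [W_i], so that [W_i] is contained in [X_x] or disjoint from it.  This
    covers M_t^n by finitely many definable sets, one of which has interior in
    any prescribed open set by induction on [n]; if [X] is dense, this yields an
    open box contained in [X]. *)

Set Implicit Arguments.
Unset Strict Implicit.
Unset Printing Implicit Defensive.

Local Open Scope classical_set_scope.

(** * Predicates definable without parameters *)

Section Logic.
Variables (L : language) (M : structure L).
Implicit Types (e : env M) (P Q : env M -> Prop).

Lemma env_ext e e' : (forall s i, e s i = e' s i) -> e = e'.
Proof.
by move=> ee'; apply: functional_extensionality_dep => s; apply/funext => i.
Qed.

Definition renv (r : fo_sort -> nat -> nat) e : env M :=
  fun s i => e s (r s i).

Fixpoint trename (r : fo_sort -> nat -> nat) (s : fo_sort) (t : term L s) :
    term L s :=
  match t with
  | Var s i => Var L s (r s i)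
  | App f ts => App (fun j => trename r (ts j))
  end.

Definition rlift (s0 : fo_sort) (r : fo_sort -> nat -> nat) (s : fo_sort)
    (i : nat) : nat :=
  match s0, s with
  | Top, Top | Bas, Bas => if i is j.+1 then (r s j).+1 else 0
  | _, _ => r s i
  end.

Fixpoint frename (r : fo_sort -> nat -> nat) (phi : formula L) : formula L :=
  match phi with
  | FEq _ t1 t2 => FEq (trename r t1) (trename r t2)
  | FRel _ ts => FRel (fun j => trename r (ts j))
  | FNeg phi => FNeg (frename r phi)
  | FAnd phi psi => FAnd (frename r phi) (frename r psi)
  | FEx s phi => FEx s (frename (rlift s r) phi)
  end.

Lemma eval_trename r e s (t : term L s) :
  Defs.eval e (trename r t) = Defs.eval (renv r e) t.
Proof.
elim: t => //= f ts IH; congr fun_int.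
by apply: functional_extensionality_dep => j; apply: IH.
Qed.

Lemma renv_rlift s r (a : M s) e :
  renv (rlift s r) (econs a e) = econs a (renv r e).
Proof. by case: s a => a; apply: env_ext => -[] []. Qed.

Lemma sat_frename r e phi : sat (frename r phi) e <-> sat phi (renv r e).
Proof.
elim: phi r e => /= [s t1 t2|R ts|phi IH|phi IH1 psi IH2|s phi IH] r e.
- by rewrite !eval_trename.
- suff -> : (fun j => Defs.eval e (trename r (ts j))) =
            (fun j => Defs.eval (renv r e) (ts j)) by [].
  by apply: functional_extensionality_dep => j; apply: eval_trename.
- by split=> H /IH.
- by split=> -[/IH1 ? /IH2 ?].
- by split=> -[a]; [rewrite IH|move=> H; exists a; rewrite IH];
    rewrite renv_rlift // => ?; exists a.
Qed.

Lemma eval_finite_support s (t : term L s) : exists N, forall e e',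
  (forall s' i, (i < N)%N -> e s' i = e' s' i) ->
  Defs.eval e t = Defs.eval e' t.
Proof.
elim: t => [s' i|f ts /choice[N HN]].
  by exists i.+1 => e e' /(_ s' i (ltnSn _)).
exists (\max_j N j) => e e' ee' /=; congr fun_int.
apply: functional_extensionality_dep => j; apply: HN => s' i iN; apply: ee'.
exact: leq_trans iN (leq_bigmax j).
Qed.

(** Only finitely many variables occur in a formula; this is what later allows the parameters of a
    definable set to be taken from a finite set. *)
Lemma sat_finite_support (phi : formula L) : exists N, forall e e',
  (forall s i, (i < N)%N -> e s i = e' s i) -> sat phi e <-> sat phi e'.
Proof.
elim: phi => [s t1 t2|R ts|phi [N HN]|phi [N1 H1] psi [N2 H2]|s phi [N HN]].
- have [N1 H1] := eval_finite_support t1.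
  have [N2 H2] := eval_finite_support t2.
  exists (maxn N1 N2) => e e' ee' /=.
  rewrite (H1 e e') ?(H2 e e') // => s' i iN; apply: ee';
  by rewrite leq_max iN ?orbT.
- have /choice[N HN] := fun j => eval_finite_support (ts j).
  exists (\max_j N j) => e e' ee' /=.
  suff -> : (fun j => Defs.eval e (ts j)) =
            (fun j => Defs.eval e' (ts j)) by [].
  apply: functional_extensionality_dep => j; apply: HN => s' i iN; apply: ee'.
  exact: leq_trans iN (leq_bigmax j).
- by exists N => e e' /HN /= ->.
- exists (maxn N1 N2) => e e' ee' /=.
  rewrite (H1 e e') ?(H2 e e') // => s' i iN; apply: ee';
  by rewrite leq_max iN ?orbT.
- exists N => e e' ee' /=.
  suff H a : sat phi (econs (s := s) a e) <-> sat phi (econs a e').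
    by split=> -[a /H ?]; exists a.
  apply: HN => s' i iN; case: s a => a; case: s' => /=; rewrite ?ee' //;
  by case: i iN => // i iN; rewrite ee' // ltnW.
Qed.

Lemma eval_term_in k s (t : term L s) e e' : term_in k t ->
  (forall s i, (i < k s)%N -> e s i = e' s i) -> Defs.eval e t = Defs.eval e' t.
Proof.
elim: t => [s' i|f ts IH] /= tin ee'; first exact: ee'.
by congr fun_int; apply: functional_extensionality_dep => j; apply: IH.
Qed.

(** Applied to the formula of the topology, this turns a basic open set into one given by a finite
    tuple of parameters, over which a formula can quantify. *)
Lemma sat_formula_in k (phi : formula L) e e' : formula_in k phi ->
  (forall s i, (i < k s)%N -> e s i = e' s i) -> sat phi e <-> sat phi e'.
Proof.
elim: phi k e e' => [s t1 t2|R ts|phi IH|phi IH1 psi IH2|s phi IH] k e e' /=.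
- by case=> t1k t2k ee'; rewrite (eval_term_in t1k ee') (eval_term_in t2k ee').
- move=> tsk ee'.
  suff -> : (fun j => Defs.eval e (ts j)) =
            (fun j => Defs.eval e' (ts j)) by [].
  by apply: functional_extensionality_dep => j; apply: (eval_term_in (tsk j)).
- by move=> phik /(IH _ _ _ phik) ->.
- by case=> k1 k2 ee'; rewrite (IH1 _ _ _ k1 ee') (IH2 _ _ _ k2 ee').
- move=> phik ee'.
  suff H a : sat phi (econs (s := s) a e) <-> sat phi (econs a e').
    by split=> -[a /H ?]; exists a.
  apply: IH phik _ => s' i; case: s a => a; case: s' => /=;
  by [exact: ee'|case: i => // i /ee'].
Qed.

(** Parameters are ordinary values of the environment here, so uniformity in the parameters is
    automatic, and the closure properties below replace writing formulas out. *)
Definition edefinable P : Prop := exists phi, forall e, P e <-> sat phi e.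

Lemma edefinable_iff P Q :
  (forall e, P e <-> Q e) -> edefinable P -> edefinable Q.
Proof. by move=> PQ [phi H]; exists phi => e; rewrite -PQ. Qed.

Lemma edefinable_not P : edefinable P -> edefinable (fun e => ~ P e).
Proof. by move=> [phi H]; exists (FNeg phi) => e /=; rewrite H. Qed.

Lemma edefinable_and P Q :
  edefinable P -> edefinable Q -> edefinable (fun e => P e /\ Q e).
Proof.
by move=> [p Hp] [q Hq]; exists (FAnd p q) => e /=; rewrite Hp Hq.
Qed.

Lemma edefinable_imply P Q :
  edefinable P -> edefinable Q -> edefinable (fun e => P e -> Q e).
Proof.
move=> dP dQ.
apply: edefinable_iff (edefinable_not (edefinable_and dP (edefinable_not dQ))).
move=> e; split=> [H Pe|H [Pe nQ]]; last exact/nQ/H.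
by apply: contrapT => nQ; apply: H.
Qed.

Lemma edefinable_ex (s : fo_sort) P :
  edefinable P -> edefinable (fun e => exists a : M s, P (econs a e)).
Proof.
by move=> [p Hp]; exists (FEx s p) => e /=; split=> -[a /Hp]; exists a.
Qed.

Lemma edefinable_rename r P :
  edefinable P -> edefinable (fun e => P (renv r e)).
Proof.
by move=> [p Hp]; exists (frename r p) => e; rewrite sat_frename.
Qed.

Lemma edefinable_eq s i j : edefinable (fun e => e s i = e s j).
Proof. by exists (FEq (Var L s i) (Var L s j)). Qed.

Lemma edefinable_forall_fin (I : finType) (P : I -> env M -> Prop) :
  (forall i, edefinable (P i)) -> edefinable (fun e => forall i, P i e).
Proof.
move=> dP.
suff H (r : seq I) : edefinable (fun e => forall i, i \in r -> P i e).
  by apply: edefinable_iff (H (enum I)) => e; split=> H' i; move: (H' i);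
     rewrite mem_enum; [exact|].
elim: r => [|i r IH].
  (* The empty conjunction is rendered by the formula [x = x]. *)
  by apply: edefinable_iff (edefinable_eq Top 0 0).
apply: edefinable_iff (edefinable_and (dP i) IH) => e; split.
  by move=> [Pi Pr] j; rewrite inE => /orP[/eqP ->|/Pr].
by move=> H; split=> [|j jr]; apply: H; rewrite inE ?eqxx // jr orbT.
Qed.

(** * Tuples of variables and saturation *)

Fixpoint epush (s : fo_sort) (n : nat) : ('I_n -> M s) -> env M -> env M :=
  match n with
  | 0 => fun _ e => e
  | n'.+1 => fun x e => econs (x ord0) (epush (fun j => x (lift ord0 j)) e)
  end.

Lemma epush_ord s n (x : 'I_n -> M s) e (i : 'I_n) : epush x e s i = x i.
Proof.
elim: n x e i => [|n IH] x e i /=; first by case: i.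
by case: (unliftP ord0 i) => [j|] -> /=; case: s x IH => x IH //=; exact: IH.
Qed.

Lemma epush_shift s n (x : 'I_n -> M s) e i : epush x e s (n + i) = e s i.
Proof.
by elim: n x e => [|n IH] x e //; rewrite addSn;
  case: s x IH => x IH /=; apply: IH.
Qed.

Lemma epush_Bas n (x : 'I_n -> M Top) e i : epush x e Bas i = e Bas i.
Proof. by elim: n x e => //= n IH x e; rewrite IH. Qed.

Lemma epush_Top n (x : 'I_n -> M Bas) e i : epush x e Top i = e Top i.
Proof. by elim: n x e => //= n IH x e; rewrite IH. Qed.

Lemma edefinable_epush s n P : edefinable P ->
  edefinable (fun e => exists x : 'I_n -> M s, P (epush x e)).
Proof.
elim: n P => [|n IH] P dP.
  apply: edefinable_iff dP => e; split=> [Pe|[]//].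
  have x : 'I_0 -> M s by case.
  by exists x.
apply: edefinable_iff (IH _ (edefinable_ex s dP)) => e; split.
  move=> [x [a Pax]] /=.
  exists (fun i => if unlift ord0 i is Some j then x j else a).
  rewrite unlift_none (_ : (fun _ => _) = x) //.
  by apply/funext => j; rewrite liftK.
by move=> [x Px]; exists (fun j => x (lift ord0 j)), (x ord0).
Qed.

Lemma renv_epush n (r : fo_sort -> nat -> nat) (x : 'I_n -> M Top) e e' :
  (forall i : 'I_n, e' Top (r Top i) = x i) ->
  (forall i, e' Top (r Top (n + i)) = e Top i) ->
  (forall i, e' Bas (r Bas i) = e Bas i) -> renv r e' = epush x e.
Proof.
move=> H1 H2 H3; apply: env_ext => -[] i; rewrite /renv ?epush_Bas //.
case: (ltnP i n) => [ltin|/subnKC <-]; last by rewrite epush_shift.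
exact: etrans (H1 (Ordinal ltin)) (esym (epush_ord _ _ (Ordinal ltin))).
Qed.

(* [omega_saturated] is about types in one variable, so the [n] variables are
   realized one at a time. *)
Lemma saturation (n : nat) (theta : nat -> env M -> Prop) e :
  omega_saturated M ->
  (forall k, edefinable (theta k)) ->
  (forall k e, theta k.+1 e -> theta k e) ->
  (forall s, finite_set (range (e s))) ->
  (forall k, exists x : 'I_n -> M Top, theta k (epush x e)) ->
  exists x : 'I_n -> M Top, forall k, theta k (epush x e).
Proof.
move=> satM; elim: n theta => [|n IH] theta dth decr fine ex.
  by have [x _] := ex 0; exists x => k; have [] := ex k.
have [||||x Hx] := IH (fun k e => exists a : M Top, theta k (econs a e)).
- by move=> k; apply: edefinable_ex.
- by move=> k e' [a /decr]; exists a.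
- exact: fine.
- by move=> k; have [x tx] := ex k; exists (fun j => x (lift ord0 j)), (x ord0).
have /choice[phi Hphi] := dth.
have decr' k k' e' : (k <= k')%N -> theta k' e' -> theta k e'.
  move/subnKC <-; elim: (k' - k)%N => [|d IHd]; rewrite ?addn0 ?addnS //.
  by move=> /decr.
have [|||a Ha] := satM Top (fun s => range (epush x e s))
  [set (phi k, epush x e) | k in setT].
- case.
    apply: (@sub_finite_set _ _ (range x `|` range (e Top))).
      move=> _ [i _ <-]; case: (ltnP i n) => [ltin|/subnKC <-].
        by left; exists (Ordinal ltin); rewrite // -(epush_ord x e).
      by right; rewrite epush_shift; exists (i - n)%N.
    by rewrite finite_setU; split=> //; apply/finite_image/finite_finset.
  apply: sub_finite_set (fine Bas) => _ [i _ <-].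
  by rewrite epush_Bas; exists i.
- by move=> _ [k _ <-] s' i; exists i.
(* As [theta] decreases, finitely many formulas of the type all follow from the one with the largest
   index [N], which the choice of [x] makes satisfiable. *)
- move=> q finq qp.
  have /choice[K HK] : forall psi, exists k, q psi -> psi = (phi k, epush x e).
    by move=> psi; have [/qp[k _ <-]|] := pselect (q psi); [exists k|exists 0].
  have [N HN] : exists N, forall psi, q psi -> (K psi <= N)%N.
    have /finite_seqP[r rE] := finite_image K finq.
    exists (\max_(k <- r) k) => psi qpsi.
    have Kr : [set` r] (K psi) by rewrite -rE; exists psi.
    by apply: leq_bigmax_seq.
  have [a Ha] := Hx N; exists a => psi qpsi.
  by rewrite (HK _ qpsi) /= -Hphi; apply: decr' (HN _ qpsi) Ha.
exists (fun i => if unlift ord0 i is Some j then x j else a) => k /=.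
rewrite unlift_none Hphi (_ : (fun _ => _) = x).
  by apply: (Ha (phi k, epush x e)); exists k.
by apply/funext => j; rewrite liftK.
Qed.

End Logic.

(** * Definable sets *)

Definition boundary (T : topologicalType) (S : set T) :=
  closure S `&` closure (~` S).

Lemma interior_notin_boundary (T : topologicalType) (S : set T) x :
  ~ boundary S x -> S x -> S° x.
Proof.
move=> nbd Sx; apply: contrapT => nint; apply: nbd; split.
  exact: subset_closure.
by rewrite closure_setC.
Qed.

Lemma boundaryC (T : topologicalType) (S : set T) :
  boundary (~` S) = boundary S.
Proof. by rewrite /boundary setCK setIC. Qed.

Section Definable.
Variables (L : language) (M : top_structure L).
Implicit Types (e : env M) (P Q : env M -> Prop).

Definition tpush n (x : power M n) e : env M := epush (s := Top) x e.

(** The new coordinate goes in front: it becomes variable 0, the one that a quantifier binds. *)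
Definition pcons n (y : points M) (x : power M n) : power M n.+1 :=
  fun i => if unlift ord0 i is Some j then x j else y.

Lemma pcons0 n y (x : power M n) : pcons y x ord0 = y.
Proof. by rewrite /pcons unlift_none. Qed.

Lemma pconsS n y (x : power M n) j : pcons y x (lift ord0 j) = x j.
Proof. by rewrite /pcons liftK. Qed.

Lemma pcons_eta n (z : power M n.+1) :
  z = pcons (z ord0) (fun j => z (lift ord0 j)).
Proof.
by apply: functional_extensionality_dep => i; case: (unliftP ord0 i) => [j|] ->;
  rewrite ?pconsS ?pcons0.
Qed.

Lemma tpush_pcons n y (x : power M n) e :
  tpush (pcons y x) e = econs (s := Top) y (tpush x e).
Proof.
rewrite /tpush /= pcons0; 
suff -> : (fun j => pcons y x (lift ord0 j)) = x by [].
by apply/funext => j; rewrite pconsS.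
Qed.

Lemma evec_tpush n (x : power M n) e e' :
  (forall i, e' Top (n + i) = e Top i) -> e' Bas = e Bas ->
  evec x e' = tpush x e.
Proof.
move=> eT eB; apply: env_ext => -[] i; rewrite /tpush /=;
  last by rewrite epush_Bas eB.
case: insubP => [j jn <-|]; first by rewrite epush_ord.
by rewrite -leqNgt => /subnKC <-; rewrite epush_shift eT.
Qed.

Lemma definable_edefinable n (X : set (power M n)) : definable X ->
  exists P e, [/\ edefinable P, forall s, finite_set (range (e s)) &
                  X = [set x | P (tpush x e)]].
Proof.
move=> [phi [e ->]]; have [N HN] := sat_finite_support M phi.
(* [evec] overwrites the first [n] variables whereas [tpush] shifts the others by [n]; [e0]
   compensates for this. Freezing all values from index [N] on makes the range finite and does not
   affect [phi]. *)
pose e0 : env M := fun s i => if s is Top then e s (n + i) else e s i.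
exists (sat phi), (fun s i => e0 s (if (i < N)%N then i else N)); split.
- by exists phi.
- move=> s; apply: (@sub_finite_set _ _ ((e0 s) @` `I_N.+1)).
    move=> _ [i _ <-]; eexists; last reflexivity.
    by rewrite /=; case: ifP => // /ltnW.
  exact/finite_image/finite_II.
apply/seteqP; split=> x /=; rewrite (@evec_tpush _ _ e0) //;
  apply: (iffLR (HN _ _ _)) => s i iN; rewrite /tpush;
  (case: s; last by rewrite !epush_Bas iN);
  (case: (ltnP i n) => [ltin|/subnKC ni];
    first by rewrite !(epush_ord _ _ (Ordinal ltin)));
  by rewrite -ni !epush_shift (leq_ltn_trans _ iN) // leq_subr.
Qed.

Lemma edefinable_definable n P e : edefinable P ->
  definable [set x : power M n | P (tpush x e)].
Proof.
move=> [phi Hphi].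
exists phi, (fun s i => if s is Top then e s (i - n)%N else e s i).
apply/seteqP; split=> x /= /Hphi; rewrite (@evec_tpush _ _ e) // => i.
  by rewrite addKn.
by rewrite addKn.
Qed.

(* The parameters of two sets are merged by interleaving them: [b] is the parity
   of the indices at which the parameters are found. *)
Definition rmerge (n b : nat) (s : fo_sort) (i : nat) : nat :=
  if s is Top then (if (i < n)%N then i else n + ((i - n).*2 + b)%N)
  else (i.*2 + b)%N.

Lemma renv_rmerge n (b : bool) (x : power M n) e e' :
  (forall s i, e' s (i.*2 + b)%N = e s i) ->
  renv (rmerge n b) (tpush x e') = tpush x e.
Proof.
move=> H; apply: renv_epush => [i|i|i] /=.
- by rewrite ltn_ord [LHS]epush_ord.
- by rewrite ltnNge leq_addr /= addKn [LHS]epush_shift.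
- by rewrite [LHS]epush_Bas.
Qed.

Lemma definable_common n (X Y : set (power M n)) : definable X -> definable Y ->
  exists P Q e, [/\ edefinable P, edefinable Q,
    X = [set x | P (tpush x e)] & Y = [set x | Q (tpush x e)]].
Proof.
move=> /definable_edefinable[P [e1 [dP _ ->]]].
move=> /definable_edefinable[Q [e2 [dQ _ ->]]].
pose e : env M := fun s i => if odd i then e2 s i./2 else e1 s i./2.
exists (fun e => P (renv (rmerge n false) e)).
exists (fun e => Q (renv (rmerge n true) e)), e.
have H1 (x : power M n) : renv (rmerge n false) (tpush x e) = tpush x e1.
  by apply: (@renv_rmerge n false) => s i; rewrite /e addn0 odd_double doubleK.
have H2 (x : power M n) : renv (rmerge n true) (tpush x e) = tpush x e2.
  apply: (@renv_rmerge n true) => s i.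
  by rewrite /e addn1 /= odd_double uphalf_double.
split; try exact: edefinable_rename.
- by apply/seteqP; split=> x /=; rewrite H1.
- by apply/seteqP; split=> x /=; rewrite H2.
Qed.

Lemma definableC n (X : set (power M n)) : definable X -> definable (~` X).
Proof.
move=> /definable_edefinable[P [e [/edefinable_not dP _ ->]]].
exact: edefinable_definable dP.
Qed.

Lemma definableI n (X Y : set (power M n)) :
  definable X -> definable Y -> definable (X `&` Y).
Proof.
move=> dX dY; have [P [Q [e [dP dQ -> ->]]]] := definable_common dX dY.
exact: edefinable_definable (edefinable_and dP dQ).
Qed.

Lemma definableU n (X Y : set (power M n)) :
  definable X -> definable Y -> definable (X `|` Y).
Proof.
move=> dX dY; rewrite -[_ `|` _]setCK setCU; apply: definableC.
by apply: definableI; apply: definableC.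
Qed.

Lemma definableT n : definable [set: power M n].
Proof.
have [a] := carrier_inhabited M Top; have [b] := carrier_inhabited M Bas.
pose e : env M := fun s i => match s with Top => a | Bas => b end.
have := @edefinable_definable n _ e (edefinable_eq M Top 0 0).
by rewrite (_ : [set x | _] = setT) //; apply/seteqP; split.
Qed.

Lemma definable_forall_fin n (I : finType) (X : I -> set (power M n)) :
  (forall i, definable (X i)) -> definable [set x | forall i, X i x].
Proof.
move=> dX; suff H (r : seq I) : definable [set x | forall i, i \in r -> X i x].
  rewrite (_ : [set x | _] = [set x | forall i, i \in enum I -> X i x]) //.
  by apply/seteqP; split=> x /= Xx i; move: (Xx i); rewrite mem_enum //; exact.
elim: r => [|i r IH].
  by rewrite (_ : [set x | _] = setT); [exact: definableT|apply/seteqP; split].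
rewrite (_ : [set x | _] = X i `&` [set x | forall i, i \in r -> X i x]).
  exact: definableI.
apply/seteqP; split=> x /=.
  by move=> H; split=> [|j jr]; apply: H; rewrite inE ?eqxx // jr orbT.
by move=> [Pi Pr] j; rewrite inE => /orP[/eqP ->|/Pr].
Qed.

Lemma definable_preimage n m (f : 'I_m -> 'I_n) (X : set (power M m)) :
  definable X -> definable [set x : power M n | X (fun i => x (f i))].
Proof.
move=> /definable_edefinable[P [e [dP _ ->]]].
pose r s i := if s is Top then (if insub i is Some j then f j : nat
                                else n + (i - m))%N else i.
have H (x : power M n) : renv r (tpush x e) = tpush (fun i => x (f i)) e.
  apply: renv_epush => i; rewrite /r /= ?[LHS]epush_Bas //.
    by rewrite valK [LHS]epush_ord.
  by rewrite insubN ?addKn ?[LHS]epush_shift // -leqNgt leq_addr.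
have := @edefinable_definable n _ e (edefinable_rename r dP).
by congr definable; apply/seteqP; split=> x /=; rewrite H.
Qed.

Lemma definable_projection n (X : set (power M n.+1)) :
  definable X -> definable [set x | exists y, X (pcons y x)].
Proof.
move=> /definable_edefinable[P [e [dP _ ->]]].
have := @edefinable_definable n _ e (edefinable_ex Top dP).
by congr definable; apply/seteqP; split=> x /= -[y Py]; exists y;
  move: Py; rewrite tpush_pcons.
Qed.

Lemma definable1_edefinable (S : set (points M)) : definable1 S ->
  exists P e, edefinable P /\ S = [set y | P (econs (s := Top) y e)].
Proof.
move=> /definable_edefinable[P [e [dP _ SP]]]; exists P, e; split=> //.
by apply/seteqP; split=> y; move/seteqP: SP => [SP1 SP2];
  [move=> Sy; have /SP1 := Sy : [set x : power M 1 | S (x ord0)] (fun=> y)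
  |move=> Py; apply: (SP2 (fun=> y))].
Qed.

Lemma edefinable_definable1 P e : edefinable P ->
  definable1 [set y : points M | P (econs (s := Top) y e)].
Proof. exact: (@edefinable_definable 1). Qed.

Lemma definable_coord n (i : 'I_n) (S : set (points M)) :
  definable1 S -> definable [set x : power M n | S (x i)].
Proof. exact: (definable_preimage (fun=> i)). Qed.

Lemma definable1_fiber n (X : set (power M n.+1)) x :
  definable X -> definable1 [set y | X (pcons y x)].
Proof.
move=> /definable_edefinable[P [e [dP _ ->]]].
have := edefinable_definable1 (tpush x e) dP.
by congr definable1; apply/seteqP; split=> y /=; rewrite tpush_pcons.
Qed.

Lemma definable1_set1 (v : points M) : definable1 [set v].
Proof.
have [b] := carrier_inhabited M Bas.
pose e : env M := fun s => match s with Top => fun=> v | Bas => fun=> b end.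
exact: (edefinable_definable1 e (edefinable_eq M Top 0 1)).
Qed.

Lemma definable1C (S : set (points M)) : definable1 S -> definable1 (~` S).
Proof. exact: definableC. Qed.

Lemma definable1I (S T : set (points M)) :
  definable1 S -> definable1 T -> definable1 (S `&` T).
Proof. exact: definableI. Qed.

Lemma definable1D (S T : set (points M)) :
  definable1 S -> definable1 T -> definable1 (S `\` T).
Proof. by move=> dS /definable1C; exact: definable1I. Qed.

Lemma basic_set_definable1 (U : set (points M)) :
  basic_sets M (ts_formula M) U -> definable1 U.
Proof.
by move=> [e ->]; apply: edefinable_definable1; exists (ts_formula M).
Qed.

Lemma basic_set_open (U : set (points M)) :
  basic_sets M (ts_formula M) U -> open U.
Proof. by move=> bU; apply/open_pointsP => x Ux; exists U; split. Qed.

Lemma nbhs_basic_set (y : points M) (S : set (points M)) : nbhs y S ->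
  exists U, [/\ basic_sets M (ts_formula M) U, U y & U `<=` S].
Proof.
rewrite nbhsE => -[V [/open_pointsP oV Vy] VS].
by have [U [bU Uy UV]] := oV y Vy; exists U; split=> //; apply: subset_trans VS.
Qed.

(** Variable 0 of sort [Top] is reserved for the point whose membership in a closure is tested;
    [etail] removes it to recover the parameters of the set. *)
Definition etail e : env M := renv (fun s i => if s is Top then i.+1 else i) e.

(* Quantifying over the basic neighbourhoods of [y] makes the closure of a
   family of sets definable uniformly in the parameters. *)
Lemma edefinable_closure P : edefinable P -> edefinable (fun e =>
  closure [set z : points M | P (econs (s := Top) z (etail e))] (e Top 0)).
Proof.
move=> dP; set m := ts_arity M; set phi := ts_formula M.
have dphi : edefinable (sat (M := M) phi) by exists phi.
(* Under the quantifiers, the element [z] is variable 0 of sort [Top], the tested point is variable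
   1, and the parameters of the basic set are the first [m] variables of sort [Bas]; [P] must skip
   the last two groups. *)
pose r s i := if s is Top then (if i is j.+1 then j.+2 else 0) else (m + i)%N.
pose near_P (E : env M) := exists z : M Top,
  sat phi (econs z E) /\ P (renv r (econs z E)).
have dnear_P : edefinable near_P.
  exact: edefinable_ex (edefinable_and dphi (edefinable_rename r dP)).
(* The basic set contains the tested point but misses the set defined by [P]; the point is in the
   closure when no parameters do this. *)
pose miss (E : env M) := sat phi (econs (s := Top) (E Top 0) E) /\ ~ near_P E.
have dmiss : edefinable miss.
  apply: edefinable_and (edefinable_not dnear_P).
  pose r0 s i := if s is Top then (if i is j.+1 then j else 0) else i.
  apply: edefinable_iff (edefinable_rename r0 dphi) => e.
  rewrite (_ : renv r0 e = econs (s := Top) (e Top 0) e) //.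
  by apply: env_ext => -[] [].
have := edefinable_not (edefinable_epush Bas m dmiss).
apply: edefinable_iff => e /=.
have H (b : 'I_m -> M Bas) z :
    renv r (econs (s := Top) z (epush b e)) = econs (s := Top) z (etail e).
  apply: env_ext => -[] i; rewrite /renv /=; last by rewrite epush_shift.
  by case: i => //= i; rewrite epush_Top.
split.
  move=> nb B /nbhs_basic_set[U [[e' UE] Ue UB]].
  apply: contrapT => nz; apply: nb; exists (fun i => e' Bas i).
  have HU z : U z <-> sat phi (econs (s := Top) z
      (epush (fun i : 'I_m => e' Bas i) e)).
    rewrite UE /=.
    apply: (sat_formula_in (ts_formula_in M)) => -[] [|i] //= ilt.
      by rewrite (epush_ord (fun i : 'I_m => e' Bas i) e (Ordinal ilt)).
    by rewrite (epush_ord (fun i : 'I_m => e' Bas i) e (Ordinal ilt)).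
  split; first by rewrite epush_Top; apply/HU.
  move=> [z [/HU Uz]]; rewrite H => Pz; apply: nz; exists z; split=> //.
  exact: UB.
move=> cl [b []]; rewrite epush_Top => sy nz.
have [|z [Pz sz]] := cl [set z | sat phi (econs (s := Top) z (epush b e))].
  apply: open_nbhs_nbhs; split=> //; apply: basic_set_open.
  by exists (epush b e).
by apply: nz; exists z; rewrite H.
Qed.

Lemma edefinable_boundary P : edefinable P -> edefinable (fun e =>
  boundary [set z : points M | P (econs (s := Top) z (etail e))] (e Top 0)).
Proof.
move=> dP; apply: edefinable_and; first exact: edefinable_closure.
exact: (edefinable_closure (edefinable_not dP)).
Qed.

Lemma etail_econs y e : etail (econs (s := Top) y e) = e.
Proof. by apply: env_ext => -[]. Qed.

Lemma definable1_boundary (S : set (points M)) :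
  definable1 S -> definable1 (boundary S).
Proof.
move=> /definable1_edefinable[P [e [dP ->]]].
have := edefinable_definable1 e (edefinable_boundary dP).
by congr definable1; apply/seteqP; split=> y /=; rewrite etail_econs.
Qed.

End Definable.

(** * The topology of M_t^n *)

Section PowerTopology.
Variables (L : language) (M : top_structure L) (n : nat).

Definition box (U : 'I_n -> set (points M)) : set (power M n) :=
  [set x | forall i, U i (x i)].

Lemma open_box (U : 'I_n -> set (points M)) :
  (forall i, open (U i)) -> open (box U).
Proof.
move=> oU; rewrite openE => x Ux; 
apply: (@filter_forall _ _ (fun i y => U i (y i)) (nbhs x)) => i.
exact: (@proj_continuous _ (fun=> points M) i x _
          (open_nbhs_nbhs (conj (oU i) (Ux i)))).
Qed.

Lemma nbhs_box (x : power M n) (O : set (power M n)) : nbhs x O ->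
  exists U, [/\ forall i, basic_sets M (ts_formula M) (U i), box U x &
                box U `<=` O].
Proof.
move=> Ox; suff [U [Ux UO]] : exists U : 'I_n -> set (points M),
    (forall i, nbhs (x i) (U i)) /\ box U `<=` O.
  have /choice[V HV] := fun i => nbhs_basic_set (Ux i).
  exists V; split=> [i|i|y Vy]; try by have [] := HV i.
  by apply: UO => i; have [_ _] := HV i; apply; apply: Vy.
(* The sets containing a box around [x] form a filter that converges to [x] in each coordinate,
   hence in the product topology, so it contains every neighbourhood of [x]. *)
pose F : set_system (power M n) := [set O |
  exists U, (forall i, nbhs (x i) (U i)) /\ box U `<=` O].
have FF : Filter F.
  split.
  - by exists (fun=> setT); split=> // i; apply: filterT.
  - move=> A B [U [Ux UA]] [V [Vx VB]]; exists (fun i => U i `&` V i).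
    split=> [i|y UVy]; first exact: filterI.
    by split; [apply: UA|apply: VB] => i; have [] := UVy i.
  - by move=> A B AB [U [Ux UA]]; exists U; split=> //; apply: subset_trans AB.
have : F --> x.
  apply/cvg_sup => i A /=.
  move=> [B [[V oV <-] Vx] BA].
  exists (fun j => if j == i then V else setT); split=> [j|y Vy].
    case: eqP => [->|_]; last exact: filterT.
    exact: open_nbhs_nbhs.
  by apply: BA; have := Vy i; rewrite eqxx.
exact.
Qed.

Lemma definable_box (U : 'I_n -> set (points M)) :
  (forall i, definable1 (U i)) -> definable (box U).
Proof.
by move=> dU; apply: definable_forall_fin => i; apply: definable_coord.
Qed.

Lemma open_definable_subset (O : set (power M n)) : open O -> O !=set0 ->
  exists B, [/\ open B, definable B, B !=set0 & B `<=` O].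
Proof.
move=> oO [x Ox].
have [U [bU Ux UO]] := nbhs_box (open_nbhs_nbhs (conj oO Ox)).
exists (box U); split=> //; last by exists x.
  by apply: open_box => i; apply: basic_set_open.
by apply: definable_box => i; apply: basic_set_definable1.
Qed.

End PowerTopology.

Lemma open_pcons (L : language) (M : top_structure L) n (W : set (points M))
    (C : set (power M n)) : open W -> open C ->
  open [set z : power M n.+1 | W (z ord0) /\ C (fun j => z (lift ord0 j))].
Proof.
move=> oW oC; rewrite openE => z [Wz Cz].
have [U [bU Uz UC]] := nbhs_box (open_nbhs_nbhs (conj oC Cz)).
pose U' i := if unlift ord0 i is Some j then U j else W.
apply: (@filterS _ _ _ (box U')) => [x U'x|].
  split; first by have := U'x ord0; rewrite /U' unlift_none.
  by apply: UC => j; have := U'x (lift ord0 j); rewrite /U' liftK.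
apply: open_nbhs_nbhs; split.
  apply: open_box => i; rewrite /U'; case: (unlift ord0 i) => // j.
  exact: basic_set_open.
by move=> i; rewrite /U'; case: unliftP => [j|] ->; [exact: Uz|].
Qed.

(** * Decomposition into indecomposable clopen pieces *)

Section Indecomposable.
Variables (L : language) (M : top_structure L).

(** A definable clopen set that properly cuts one of the [d] pieces would give a splitting into
    [d.+1] pieces, against maximality. *)
Lemma d_eq_indecomposable (X : set (points M)) d : d_eq X d ->
  exists C : 'I_d -> set (points M),
    [/\ forall i, definable1 (C i),
        forall i, clopen (C i : set (subspace X)),
        \bigcup_i C i = X &
        forall i A, definable1 A -> clopen (A `&` C i : set (subspace X)) ->
          A `&` C i !=set0 -> C i `\` A !=set0 -> False].
Proof.
move=> [[C [HC disC CX]] dmax]; exists C.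
split=> [i|i||j A dA clA AC CA] //; try by case: (HC i).
have disj k k' x : C k x -> C k' x -> k = k'.
  by move=> Cx Cx'; apply: disC => //; exists x.
have [dC _ clC] := HC j.
suff: splits X d.+1 by move/dmax; rewrite ltnn.
(* The piece [C j] is replaced by its part outside [A]; its part inside [A] takes the new index
   [ord0]. *)
exists (fun i => if unlift ord0 i is Some k then
                   (if k == j then C j `\` A else C k) else A `&` C j); split.
- move=> i; case: unliftP => [k|] _.
    case: eqP => _; last exact: HC.
    split=> //; first exact: definable1D.
    rewrite (_ : C j `\` A = C j `&` ~` (A `&` C j)).
      by apply: clopenI => //; apply: (clopenC set0).
    by apply/seteqP; split=> x /= [Cx nA]; split=> //;
      [case|move=> Ax; apply: nA].
  by split=> //; apply: definable1I.
- move=> i i' _ _; case: (unliftP ord0 i) => [k|] ->;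
    case: (unliftP ord0 i') => [k'|] -> //= [x].
  + case: eqP => [->|kj]; case: eqP => [->|k'j] //.
    * by move=> [[Cx _] Cx']; rewrite (disj _ _ _ Cx Cx').
    * by move=> [Cx [Cx' _]]; rewrite (disj _ _ _ Cx Cx').
    * by move=> [Cx Cx']; rewrite (disj _ _ _ Cx Cx').
  + case: eqP => [->|kj]; first by move=> [[_ nA] []].
    by move=> [Cx [_ Cx']]; case: kj; apply: disj Cx Cx'.
  + case: eqP => [->|kj]; first by move=> [[Ax _] []].
    by move=> [[_ Cx'] Cx]; case: kj; apply: disj Cx Cx'.
rewrite -CX; apply/seteqP; split=> [x [i _]|x [i _ Cx]].
  case: (unliftP ord0 i) => [k|] _; last by case=> _ Cx; exists j.
  by case: eqP => [_ [Cx _]|_ Cx]; [exists j|exists k].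
have [ij|/eqP/negbTE ij] := pselect (i = j); last first.
  by exists (lift ord0 i) => //; rewrite liftK ij.
subst i.
have [Ax|nAx] := pselect (A x).
  by exists ord0 => //; rewrite unlift_none.
by exists (lift ord0 j) => //; rewrite liftK eqxx.
Qed.

End Indecomposable.

(** * One-dimensional t.t.t structures *)

Section OneDimensional.
Variables (L : language) (M : top_structure L).
Hypothesis tttM : one_ttt M.

Lemma hausdorff_points : hausdorff_space (points M).
Proof. by case: tttM => -[]. Qed.

Lemma closed_set1_points (a : points M) : closed [set a].
Proof.
exact: accessible_closed_set1 (hausdorff_accessible hausdorff_points) a.
Qed.

Lemma closed_no_interior_finite (Y : set (points M)) :
  closed Y -> definable1 Y -> Y° = set0 -> finite_set Y.
Proof.
move=> clY dY Y0; have [[_ _ _ dfin] [_ ndim]] := tttM.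
have oY a : Y a -> open ([set a] : set (subspace Y)).
  (* If [a] is not isolated in [Y], then [[set a]] has no interior in [Y], and [Y] has none in M_t:
     this chain gives M_t dimension at least 2. *)
  move=> Ya; apply: contrapT => noa; apply: ndim.
  exists Y; split=> //.
    rewrite -subset0 -Y0 => x.
    by rewrite /interior nbhs_subspaceT.
  exists [set a]; split=> //; last by exists a.
  - exact: closed_set1_points.
  - exact: definable1_set1.
  - by move=> _ ->.
  - rewrite -subset0 => x xa; apply: noa.
    have xE : x = a := @interior_subset (subspace Y) _ _ xa.
    by rewrite openE => _ ->; rewrite -xE in xa *.
have [d dYd] := dfin Y dY.
have [C [dC clC CY indec]] := d_eq_indecomposable dYd.
rewrite -CY; apply: bigcup_finite => [|i _]; first exact: finite_finset.
have [[a Ca]|nC] := pselect (C i !=set0); last first.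
  by apply: sub_finite_set (finite_set0 _) => a Ca; apply: nC; exists a.
(* A second point [b] in the piece would be cut off from [a] by the clopen set [[set a]]. *)
apply: sub_finite_set (finite_set1 a) => b Cb; apply: contrapT => /= ba.
have Ya : Y a by rewrite -CY; exists i.
apply: (indec i [set a]); rewrite ?set1I ?(mem_set Ca).
- exact: definable1_set1.
- by split; [exact: oY|apply: closed_subspaceW; exact: closed_set1_points].
- by exists a.
- by exists b; split.
Qed.

(** The boundary has no interior: an open set inside it would meet [U], yet no point of the open set
    [U] is in the closure of the complement. *)
Lemma boundary_open_finite (U : set (points M)) :
  open U -> definable1 U -> finite_set (boundary U).
Proof.
move=> oU dU; apply: closed_no_interior_finite.
- by apply: closedI; apply: closed_closure.
- exact: definable1_boundary.
- rewrite -subset0 => x; rewrite /interior => xbd.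
  have [clU _] := nbhs_singleton xbd.
  have [y [Uy [_ ncl]]] := clU _ xbd.
  by have [z []] := ncl U (open_nbhs_nbhs (conj oU Uy)).
Qed.

(** By condition (A) open sets suffice: complements have the same boundary, and the boundary of an
    intersection lies in the union of the boundaries. *)
Lemma boundary_finite (S : set (points M)) :
  definable1 S -> finite_set (boundary S).
Proof.
move=> dS; have [[condA _ _ _] _] := tttM.
elim: (condA S dS) => [U [dU oU]|U _ IH|U V _ IHU _ IHV].
- exact: boundary_open_finite.
- by rewrite /boundary setCK setIC.
- have fin : finite_set (boundary U `|` boundary V) by rewrite finite_setU.
  apply: sub_finite_set fin => x [].
  rewrite setCI closureU => /closureI[clU clV].
  by move=> -[nU|nV]; [left|right].
Qed.

(** For open [W], missing the boundary of [S] means that the trace of [S] on [W] is clopen in [W];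
    this form fits the counting of boundary points. *)
Definition definably_connected (W : set (points M)) :=
  forall S, definable1 S -> W `&` boundary S = set0 -> W `<=` S \/ W `<=` ~` S.

(** An indecomposable piece of [V] works; it is open because it is open in the open set [V]. *)
Lemma open_definably_connected_subset (V : set (points M)) :
  open V -> definable1 V -> V !=set0 ->
  exists W, [/\ open W, definable1 W, W !=set0, W `<=` V &
                definably_connected W].
Proof.
move=> oV dV [v Vv]; have [[_ _ _ dfin] _] := tttM.
have [d dVd] := dfin V dV.
have [C [dC clC CV indec]] := d_eq_indecomposable dVd.
have [i _ Cv] : (\bigcup_i C i) v by rewrite CV.
have CiV : C i `<=` V by rewrite -CV; exact: bigcup_sup.
have oC : open (C i).
  rewrite -(setIidl CiV) open_setIS //.
  by have [] := clC i.
exists (C i); split=> //; first by exists v.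
(* Off its boundary [S] agrees with its interior. Applied to [S] and to its complement, this makes
   the trace of [S] on the piece clopen. *)
have oCS S : C i `&` boundary S = set0 -> open (S `&` C i).
  move=> Cbd; rewrite (_ : S `&` C i = S° `&` C i).
    by apply: openI => //; exact: open_interior.
  apply/seteqP; split=> x [Sx Cx]; split=> //; last exact: interior_subset.
  by apply: interior_notin_boundary => // bdx; rewrite -[False]/(set0 x) -Cbd.
move=> S dS Cbd; apply: contrapT => /not_orP[nS nC].
apply: (indec i S) => //.
- split; first exact/open_subspaceW/oCS.
  rewrite (_ : S `&` C i = C i `&` ~` (~` S `&` C i)).
    apply: closedI; first by have [] := clC i.
    by apply/open_closedC/open_subspaceW/oCS; rewrite boundaryC.
  apply/seteqP; split=> x [].
    by move=> Sx Cx; split=> // -[].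
  by move=> Cx nn; split=> //; apply: contrapT => nSx; apply: nn.
- apply: contrapT => n0; apply: nC => x Cx Sx; apply: n0; by exists x.
- apply: contrapT => n0; apply: nS => x Cx; apply: contrapT => nSx; apply: n0.
  by exists x.
Qed.

(** As no point of [V] is isolated, [V] has two points, which have disjoint neighbourhoods: one
    yields the first set, the induction takes place in the other. *)
Lemma disjoint_open_definably_connected (V : set (points M)) N :
  open V -> definable1 V -> V !=set0 -> (forall v, V v -> ~ open [set v]) ->
  exists W : 'I_N -> set (points M),
    (forall i, [/\ open (W i), definable1 (W i), W i !=set0, W i `<=` V &
                   definably_connected (W i)]) /\
    forall i j x, W i x -> W j x -> i = j.
Proof.
elim: N V => [|N IH] V oV dV V0 noiso.
  by exists (fun=> set0); split=> -[].
have [a Va] := V0.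
have [b [Vb ba]] : exists b, V b /\ b <> a.
  apply: contrapT => nb; apply: (noiso a Va).
  rewrite (_ : [set a] = V) //; apply/seteqP; split=> [_ ->//|b Vb /=].
  by apply: contrapT => ba; apply: nb; exists b.
have := hausdorff_points; rewrite open_hausdorff => /(_ a b).
have -> : a != b by apply/eqP => ab; apply: ba.
move=> /(_ isT)[[A B] /= [/set_mem Aa /set_mem Bb] [oA oB /eqP AB0]].
have [A' [bA' A'a A'A]] := nbhs_basic_set (open_nbhs_nbhs (conj oA Aa)).
have [B' [bB' B'b B'B]] := nbhs_basic_set (open_nbhs_nbhs (conj oB Bb)).
have [W0 [oW0 dW0 W00 W0V cW0]] : exists W, [/\ open W, definable1 W,
    W !=set0, W `<=` V `&` A' & definably_connected W].
  apply: open_definably_connected_subset; last by exists a.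
    by apply: openI => //; exact: basic_set_open.
  by apply: definable1I => //; exact: basic_set_definable1.
have [||||W [HW disW]] := IH (V `&` B').
- by apply: openI => //; exact: basic_set_open.
- by apply: definable1I => //; exact: basic_set_definable1.
- by exists b.
- by move=> v [/noiso].
have disj x k : W0 x -> W k x -> False.
  move=> /W0V[_ /A'A Ax]; have [_ _ _ WV _] := HW k.
  by move=> /WV[_ /B'B Bx]; rewrite -[False]/(set0 x) -AB0.
exists (fun i => if unlift ord0 i is Some k then W k else W0).
split=> [i|i j x].
  case: unliftP => [k|] _; last by split=> // x /W0V[].
  by have [? ? ? WV ?] := HW k; split=> // x /WV[].
case: (unliftP ord0 i) => [k|] ->; case: (unliftP ord0 j) => [k'|] -> //.
- by move=> Wk Wk'; rewrite (disW _ _ _ Wk Wk').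
- by move=> Wk /disj/(_ Wk).
- by move=> /disj H /H.
Qed.

(* Small boundaries cannot meet all members of a large disjoint family; if [V]
   has an isolated point, it lies in no boundary at all. *)
Lemma boundary_avoiding_family (V : set (points M)) N :
  open V -> definable1 V -> V !=set0 ->
  exists k, exists W : 'I_k -> set (points M),
    (forall i, [/\ open (W i), definable1 (W i), W i !=set0, W i `<=` V &
                   definably_connected (W i)]) /\
    forall S : set (points M),
      ~ (exists f : 'I_N -> points M,
           injective f /\ forall i, boundary S (f i)) ->
      exists i, W i `&` boundary S = set0.
Proof.
move=> oV dV V0.
have [[v Vv ov]|noiso] := pselect (exists2 v, V v & open [set v]).
  exists 1, (fun=> [set v]); split=> [_|S _].
    split=> //; first exact: definable1_set1.
    - by exists v.
    - by move=> _ ->.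
    - move=> S _ _; have [Sv|nSv] := pselect (S v); [left|right];
      by move=> _ ->.
  exists ord0; rewrite -subset0 => _ [-> [clS clnS]].
  have vv : nbhs v [set v] by exact: open_nbhs_nbhs.
  have [w [Sw /= wv]] := clS _ vv; have [w' [nSw' /= w'v]] := clnS _ vv.
  by apply: nSw'; rewrite w'v -wv.
have [||||W [HW disW]] := @disjoint_open_definably_connected V N => //.
  by move=> v Vv ov; apply: noiso; exists v.
exists N, W; split=> // S nS; apply: contrapT => nW; apply: nS.
have /choice[f Hf] : forall i, exists x, (W i `&` boundary S) x.
  move=> i; apply: contrapT => n0; apply: nW; exists i.
  by rewrite -subset0 => x Wx; apply: n0; exists x.
exists f; split=> [i j fij|i]; last by have [] := Hf i.
have [Wi _] := Hf i; have [Wj _] := Hf j.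
by apply: disW Wi _; rewrite fij.
Qed.

End OneDimensional.

(** * Dense definable sets *)

Section UniformBound.
Variables (L : language) (M : top_structure L).
Hypotheses (satM : omega_saturated M) (tttM : one_ttt M).

Definition fiber n (X : set (power M n.+1)) (x : power M n) : set (points M) :=
  [set y | X (pcons y x)].

(** Having at least [k] boundary points is a definable condition on the fiber. Were it satisfiable
    for every [k], saturation would give one fiber satisfying all of them, whose boundary would be
    infinite. *)
Lemma uniform_boundary_bound n (X : set (power M n.+1)) : definable X ->
  exists N, forall x, ~ exists f : 'I_N -> points M,
    injective f /\ forall i, boundary (fiber X x) (f i).
Proof.
move=> dX; apply: contrapT => nN.
have [P [e [dP fine XE]]] := definable_edefinable dX.
pose bd (E : env M) :=
  boundary [set z : points M | P (econs (s := Top) z (etail E))] (E Top 0).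
have bdE x y : bd (econs (s := Top) y (tpush x e)) <-> boundary (fiber X x) y.
  rewrite /bd etail_econs /fiber XE.
  rewrite (_ : [set z | _] = [set z | [set x | P (tpush x e)] (pcons z x)]) //.
  by apply/seteqP; split=> z /=; rewrite tpush_pcons.
pose theta k (E : env M) := exists f : 'I_k -> M Top,
  injective f /\ forall i, bd (econs (f i) E).
have dtheta k : edefinable (theta k).
  (* Among the [k] points pushed onto the environment, [r i] keeps the one of index [i] as variable
     0 and drops the others. *)
  pose r (i : 'I_k) s j :=
    if s is Top then (if j is j'.+1 then (k + j')%N else i : nat) else j.
  have dP1 : edefinable (fun E => forall i, bd (renv (r i) E)).
    apply: edefinable_forall_fin => i; apply: edefinable_rename.
    exact: edefinable_boundary.
  have dP2 : edefinable (fun E : env M => forall p : 'I_k * 'I_k,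
      E Top p.1 = E Top p.2 -> p.1 = p.2).
    apply: edefinable_forall_fin => p.
    apply: edefinable_imply (edefinable_eq M Top p.1 p.2) _.
    (* Equality of the indices does not depend on the environment, so it is a constantly true or
       constantly false formula. *)
    have [pp|npp] := pselect (p.1 = p.2).
      exact: edefinable_iff (edefinable_eq M Top 0 0).
    apply: edefinable_iff (edefinable_not (edefinable_eq M Top 0 0)) => E.
    by split.
  have := edefinable_epush Top k (edefinable_and dP2 dP1).
  apply: edefinable_iff => E.
  have rE (f : 'I_k -> M Top) i : renv (r i) (epush f E) = econs (f i) E.
    apply: env_ext => -[] j; rewrite /renv /= ?epush_Bas //.
    by case: j => [|j]; rewrite ?epush_ord ?epush_shift.
  split=> -[f [H1 H2]]; exists f; split=> [|i].
  - by move=> i j fij; apply: (H1 (i, j)); rewrite /= !epush_ord.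
  - by rewrite -rE.
  - by move=> [i j]; rewrite !epush_ord => /H1.
  - by rewrite rE.
have decr k E : theta k.+1 E -> theta k E.
  move=> [f [injf bdf]]; exists (fun i => f (lift ord0 i)); split=> [i j|i //].
  by move=> /injf/lift_inj.
have [k|x Hx] := saturation (n := n) satM dtheta decr fine.
  apply: contrapT => nx; apply: nN; exists k => x [f [injf bdf]]; apply: nx.
  by exists x, f; split=> // i; apply/bdE.
have /finite_seqP[s sE] := boundary_finite tttM (definable1_fiber x dX).
have [f [injf bdf]] := Hx (size s).+1.
have : uniq (codom f : seq (points M)) by apply/injectiveP.
move=> /(@uniq_leq_size _ _ s); rewrite size_codom card_ord ltnn => H.
suff : false by []; apply: H.
move=> y /codomP[i ->]; suff : [set` s] (f i) by [].
by rewrite -sE; apply/bdE.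
Qed.

End UniformBound.

(** * Finite covers and the induction on the power *)

Section DenseInterior.
Variables (L : language) (M : top_structure L).

(** Either the first set is dense inside a definable open [B], and the hypothesis gives it interior
    there, or it misses an open part of [B], which the other sets cover. *)
Lemma finite_cover_interior n k (A : 'I_k -> set (power M n)) O :
  (forall X : set (power M n), definable X -> dense X -> dense X°) ->
  (forall i, definable (A i)) -> open O -> O !=set0 ->
  O `<=` \bigcup_i A i ->
  exists i B, [/\ open B, B !=set0, B `<=` O & B `<=` A i].
Proof.
move=> denseM; elim: k A O => [|k IH] A O dA oO O0 OA.
  by have [x /OA[[]]] := O0.
have [B [oB dB B0 BO]] := open_definable_subset oO O0.
(* Adding the complement of [B] turns density within [B] into density in the whole space, to which
   the hypothesis applies. *)
have [dns|/denseNE[O' [[x [oO' O'x]] O'E]]] :=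
    pselect (dense (A ord0 `|` ~` B)).
  have [|x [Bx Ax]] := denseM (A ord0 `|` ~` B) _ dns B B0 oB.
    by apply: definableU => //; exact: definableC.
  exists ord0, (B `&` (A ord0 `|` ~` B)°); split.
  - by apply: openI => //; exact: open_interior.
  - by exists x.
  - by move=> y [/BO].
  - by move=> y [By /interior_subset[]].
have O'B : O' `<=` B.
  move=> y O'y; apply: contrapT => nBy.
  by rewrite -[False]/(set0 y) -O'E; split=> //; right.
have [||||i [C [oC C0 CO' CA]]] := IH (fun i => A (lift ord0 i)) O'.
- by move=> i; exact: dA.
- exact: oO'.
- by exists x.
- move=> y O'y; have [i _ Ay] := OA y (BO y (O'B y O'y)).
  case: (unliftP ord0 i) Ay => [j|] -> Ay; first by exists j.
  by have : set0 y by rewrite -O'E; split=> //; left.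
- exists (lift ord0 i), C; split=> //.
  by apply: subset_trans BO; apply: subset_trans O'B.
Qed.

Lemma dense_interior n (X : set (power M n)) :
  omega_saturated M -> one_ttt M -> definable X -> dense X -> dense X°.
Proof.
move=> satM tttM; elim: n X => [|n IH] X dX densX O O0 oO.
  (* M_t^0 is a single point, so a dense set is everything. *)
  have [x [Ox Xx]] := densX O O0 oO; exists x; split=> //.
  rewrite /interior (_ : X = setT); first exact: filterT.
  apply/seteqP; split=> // y _; rewrite (_ : y = x) //.
  by apply: functional_extensionality_dep => -[].
have [z Oz] := O0.
have [U [bU Uz UO]] := nbhs_box (open_nbhs_nbhs (conj oO Oz)).
have oU i := basic_set_open (bU i); have dU i := basic_set_definable1 (bU i).
pose V : set (points M) := U ord0.
pose U' : set (power M n) := box (fun j : 'I_n => U (lift ord0 j)).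
have VU' y x : V y -> U' x -> O (pcons y x).
  move=> Vy U'x; apply: UO => i.
  by case: (unliftP ord0 i) => [j|] ->; rewrite ?pcons0 ?pconsS.
have [N HN] := uniform_boundary_bound satM tttM dX.
have V0 : V !=set0 by exists (z ord0); apply: Uz.
have [k [W [HW Wbd]]] := boundary_avoiding_family tttM N (oU ord0) (dU ord0) V0.
pose inc i := [set x : power M n | W i `<=` fiber X x].
pose exc i := [set x : power M n | W i `<=` ~` fiber X x].
have dfib i (Y : set (power M n.+1)) : definable Y ->
    definable [set x | W i `<=` fiber Y x].
  move=> dY; have [_ dWi _ _ _] := HW i.
  have := definableC (definable_projection
    (definableI (definable_coord ord0 dWi) (definableC dY))).
  congr definable; apply/seteqP; split=> x /=.
    move=> nex y Wy; apply: contrapT => nY; apply: nex; exists y.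
    by rewrite pcons0.
  by move=> WY [y [+ nY]]; rewrite pcons0 => /WY.
have dinc i : definable (inc i) by exact: dfib.
have dexc i : definable (exc i) by exact: dfib (definableC dX).
have oU' : open U' by apply: open_box => j.
have U'0 : U' !=set0.
  by exists (fun j => z (lift ord0 j)) => j; apply: Uz.
(* Each [x] has some [W i] missing the boundary of its fiber, so connectedness puts [x] in [inc i]
   or [exc i]. This first use of the cover lemma fixes [i]; the second one decides between [inc i]
   and [exc i]. *)
have [||i [B [oB B0 BU' Bi]]] :=
    @finite_cover_interior n k (fun i => inc i `|` exc i) U' IH _ oU' U'0.
- by move=> i; exact: definableU.
- move=> x _; have [i Wi] := Wbd _ (HN x); exists i => //.
  have [_ _ _ _ Wconn] := HW i.
  by case: (Wconn _ (definable1_fiber x dX) Wi); [left|right].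
have [oW dW [w Ww] WV _] := HW i.
have [||b [C [oC [c Cc] CB Cb]]] := @finite_cover_interior n 2
    (fun b => if b == ord0 then inc i else exc i) B IH _ oB B0.
- by move=> b; case: eqP.
- by move=> x /Bi[]; [exists ord0|exists ord_max].
pose WC := [set z : power M n.+1 |
  W i (z ord0) /\ C (fun j => z (lift ord0 j))].
have oWC : open WC by exact: open_pcons.
have WCe : WC (pcons w c).
  rewrite /WC /= pcons0; split=> //.
  by rewrite (_ : (fun j => _) = c) //; apply/funext => j; rewrite pconsS.
(* If [C] is in [exc i], the nonempty open set [WC] misses [X], against density; otherwise [WC] is
   contained in [X]. *)
case: eqP Cb => _ Cb; last first.
  have [|x [[Wx Cx] Xx]] := densX WC _ oWC; first by exists (pcons w c).
  by have := Cb _ Cx _ Wx; rewrite /fiber /= -pcons_eta.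
exists (pcons w c); split; first by apply: VU'; [exact: WV|exact/BU'/CB].
apply: (@filterS _ _ _ WC) => [x [Wx Cx]|].
  by have := Cb _ Cx _ Wx; rewrite /fiber /= -pcons_eta.
exact: open_nbhs_nbhs.
Qed.

End DenseInterior.

Theorem proposition1 (L : language) (M : top_structure L) (n : nat)
    (X : set (power M n)) :
  omega_saturated M -> one_ttt M -> (1 <= n)%N ->
  definable X -> dense X -> dense (interior X).
Proof. by move=> satM tttM _; exact: dense_interior. Qed.
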